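(* Let $d\ge1$, $0<\gamma<1$, $\theta=(\theta_1,\dots,\theta_d)$ (row vector) with $\theta_i\ge0$, $\Theta=\operatorname{diag}(\theta_1,\dots,\theta_d)$, $N=\operatorname{diag}(\nu_1,\dots,\nu_d)$, $P=\operatorname{diag}(\rho_1,\dots,\rho_d)$ with $\rho_i\in[-1,1]$, let $D=\operatorname{diag}(\delta_1,\dots,\delta_d)$ be a diagonal matrix, $\Lambda=D+\frac{\gamma}{1-\gamma}NP\Theta$, and $K=\operatorname{diag}(K_1,\dots,K_d)$. Assume that for all $1\le i\le d$ $$\delta_i+\frac{\gamma}{1-\gamma}\nu_i\rho_i\theta_i<0\quad\text{and}\quad\Big(\delta_i+\frac{\gamma}{1-\gamma}\nu_i\rho_i\theta_i\Big)^2-\frac{\gamma}{1-\gamma}\Big(\frac{1-\gamma+\gamma\rho_i^2}{1-\gamma}\Big)\nu_i^2\theta_i^2>0 .$$ Then the Riccati–Volterra equation $$\psi(t)=\int_0^tF_2(\psi)(t-s)K(s)ds,\qquad F_2(\psi)=\frac{\gamma}{2(1-\gamma)}\theta\Theta+\psi\Lambda+\frac12\Big(\psi N^2\Psi+\frac{\gamma}{1-\gamma}\psi N^2P^2\Psi\Big),$$ with $\psi$ row-vector valued and $\Psi=\operatorname{diag}(\psi_1,\dots,\psi_d)$, has a unique global solution.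
   Context: $F_2(\psi)$ is evaluated pointwise: $F_2(\psi)(u)=F_2(\psi(u))$. Kernel assumptions: each scalar kernel $K_i$ is in $L^2_{\mathrm{loc}}(\mathbb R_+,\mathbb R)$ and completely monotone on $(0,\infty)$ (infinitely differentiable with $(-1)^nK_i^{(n)}(t)\ge0$ for all $n\ge 0$, $t>0$), and there are $\kappa_i\in(0,2]$, $k_i>0$ with $\int_0^hK_i^2(t)dt+\int_0^T(K_i(t+h)-K_i(t))^2dt\le k_ih^{\kappa_i}$ for $h>0$, where $T>0$ is the fixed horizon. A non-continuable solution of $\psi(t)=\int_0^tF(\psi)(t-s)K(s)ds$ is a pair $(\psi,T_{\max})$, $T_{\max}\in(0,\infty]$, with $\|\psi\|_{L^2[0,T']}<\infty$ for every $T'<T_{\max}$, $\psi$ satisfying the equation on $[0,T_{\max})$, and $\|\psi\|_{L^2[0,T_{\max}]}=\infty$ if $T_{\max}<\infty$. It is unique if for any $T'>0$ and any $\tilde\psi$ with $\|\tilde\psi\|_{L^2[0,T']}<\infty$ satisfying the equation on $[0,T']$ one has $T'<T_{\max}$ and $\tilde\psi=\psi$ on $[0,T']$. If $T_{\max}=\infty$, $\psi$ is a global solution. *)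

(* Defs.v *)
From HB Require Import structures.
From mathcomp Require Import all_boot all_order all_algebra.
From mathcomp Require Import all_classical all_reals all_analysis.

Set Implicit Arguments.
Unset Strict Implicit.
Unset Printing Implicit Defensive.

Import Order.TTheory GRing.Theory Num.Theory.
Import numFieldNormedType.Exports.

Local Open Scope classical_set_scope.
Local Open Scope ring_scope.

Definition L2_loc (R : realType) (f : R -> R) : Prop :=
  measurable_fun (`[0, +oo[ : set R) f /\
  forall b : R, 0 < b ->
    ('N[lebesgue_measure]_(2%:E) [(EFin \o f) \_ `[0%R, b]] < +oo)%E.

Definition completely_monotone (R : realType) (f : R -> R) : Prop :=
  forall (n : nat) (t : R), 0 < t ->
    derivable (derive1n n f) t 1 /\ 0 <= (-1) ^+ n * derive1n n f t.

Definition kernel_increment_bound (R : realType) (T : R) (f : R -> R)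
    (kappa k : R) : Prop :=
  forall h : R, 0 < h ->
    (\int[lebesgue_measure]_(t in `[0%R, h]) ((f t) ^+ 2)%:E +
     \int[lebesgue_measure]_(t in `[0%R, T]) ((f (t + h) - f t) ^+ 2)%:E
     <= (k * h `^ kappa)%:E)%E.

Definition kernel_assumption (R : realType) (T : R) (f : R -> R) : Prop :=
  [/\ L2_loc f,
      completely_monotone f
    & exists kappa k : R, [/\ 0 < kappa, kappa <= 2, 0 < k
                            & kernel_increment_bound T f kappa k]].

Definition euclidean_norm (R : realType) (d : nat) (x : 'rV[R]_d) : R :=
  Num.sqrt (\sum_(i < d) x 0 i ^+ 2).

Definition L2norm (R : realType) (d : nat) (b : R) (psi : R -> 'rV[R]_d) :
    \bar R :=
  'N[lebesgue_measure]_(2%:E)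
    [(fun t => (euclidean_norm (psi t))%:E) \_ `[0%R, b]]%E.

(* Functions are total on R; only their values on the interval matter. *)
Definition in_L2 (R : realType) (d : nat) (b : R) (psi : R -> 'rV[R]_d) :
    Prop :=
  (forall i : 'I_d, measurable_fun (`[0, b] : set R) (fun t => psi t 0 i)) /\
  (L2norm b psi < +oo)%E.

Definition volterra_integrand (R : realType) (d : nat)
    (F : 'rV[R]_d -> 'rV[R]_d) (K : R -> 'M[R]_d) (psi : R -> 'rV[R]_d)
    (t s : R) : 'rV[R]_d :=
  F (psi (t - s)) *m K s.

(* [\int[_]_(_ in _) _] is total, so integrability of the integrand, i.e. the
   existence of the convolution at t, is required explicitly. *)
Definition solves_at (R : realType) (d : nat)
    (F : 'rV[R]_d -> 'rV[R]_d) (K : R -> 'M[R]_d) (psi : R -> 'rV[R]_d)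
    (t : R) : Prop :=
  (forall j : 'I_d, lebesgue_measure.-integrable `[0, t]
     (fun s => (volterra_integrand F K psi t s 0 j)%:E)) /\
  psi t = \row_(j < d)
    (\int[lebesgue_measure]_(s in `[0, t]) volterra_integrand F K psi t s 0 j).

Definition noncontinuable_solution (R : realType) (d : nat)
    (F : 'rV[R]_d -> 'rV[R]_d) (K : R -> 'M[R]_d)
    (psi : R -> 'rV[R]_d) (Tmax : \bar R) : Prop :=
  [/\ (0 < Tmax)%E,
      forall T' : R, 0 < T' -> (T'%:E < Tmax)%E -> in_L2 T' psi,
      forall t : R, 0 <= t -> (t%:E < Tmax)%E -> solves_at F K psi t
    & (Tmax < +oo)%E -> L2norm (fine Tmax) psi = +oo%E].

(* Competitors are elements of L^2, i.e. classes modulo null sets: they are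
   only asked to solve the equation at almost every t, and are compared with
   psi almost everywhere.  As the integral in [solves_at] only depends on these
   classes, two solutions that are equal almost everywhere agree at every t at
   which both satisfy the equation. *)
Definition unique_noncontinuable (R : realType) (d : nat)
    (F : 'rV[R]_d -> 'rV[R]_d) (K : R -> 'M[R]_d)
    (psi : R -> 'rV[R]_d) (Tmax : \bar R) : Prop :=
  forall (T' : R) (psi' : R -> 'rV[R]_d), 0 < T' ->
    in_L2 T' psi' ->
    {ae lebesgue_measure, forall t : R, 0 <= t <= T' -> solves_at F K psi' t} ->
    (T'%:E < Tmax)%E /\
    {ae lebesgue_measure, forall t : R, 0 <= t <= T' -> psi' t = psi t}.

Definition has_unique_global_solution (R : realType) (d : nat)
    (F : 'rV[R]_d -> 'rV[R]_d) (K : R -> 'M[R]_d) : Prop :=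
  exists (psi : R -> 'rV[R]_d) (Tmax : \bar R),
    [/\ noncontinuable_solution F K psi Tmax,
        unique_noncontinuable F K psi Tmax
      & Tmax = +oo%E].

Definition kernel_mx (R : realType) (d : nat) (K : 'I_d -> R -> R) (t : R) :
    'M[R]_d :=
  diag_mx (\row_(i < d) K i t).

Definition Lambda_mx (R : realType) (d : nat) (gamma : R)
    (theta nu rho delta : 'rV[R]_d) : 'M[R]_d :=
  diag_mx delta +
  (gamma / (1 - gamma)) *: (diag_mx nu *m diag_mx rho *m diag_mx theta).

Definition F2 (R : realType) (d : nat) (gamma : R)
    (theta nu rho delta : 'rV[R]_d) (psi : 'rV[R]_d) : 'rV[R]_d :=
  let Theta := diag_mx theta in
  let N := diag_mx nu in
  let P := diag_mx rho in
  let Psi := diag_mx psi in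
  (gamma / (2 * (1 - gamma))) *: (theta *m Theta)
  + psi *m Lambda_mx gamma theta nu rho delta
  + 2^-1 *: (psi *m (N ^+ 2) *m Psi
             + (gamma / (1 - gamma)) *: (psi *m (N ^+ 2) *m (P ^+ 2) *m Psi)).

(* Main.v *)
Require Import Defs.
From HB Require Import structures.
From mathcomp Require Import all_boot all_order all_algebra.
From mathcomp Require Import all_classical all_reals all_analysis.
From mathcomp Require Import measurable_realfun.
From mathcomp Require Import ring lra.

(** The system is diagonal, so it splits into scalar equations
    [psi = k * Q(psi)] (convolution) for a quadratic
    [Q x = a x^2 + lam x + c] with [a, c >= 0] and [lam < 0].  Positivity of the
    discriminant yields a smallest root [xs >= 0] of [Q], and [Q] is nonnegative
    and Lipschitz on [[0, xs]].

    Existence: replace [Q] by [G := Q o clamp], with values clamped to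
    [[0, xs]].  [G] is bounded and globally Lipschitz, so Picard iteration
    converges in the norms [sup_[0,b] e^(- beta t) |u t|], [beta] large.  The
    solution is nonnegative because [k] and [G] are.  It stays below [xs]
    because [k] is nonincreasing: if [psi T > xs] and [t] is the last time
    before [T] with [psi t <= xs], then [G(psi)] vanishes on [(t, T]], so
    [psi T = int_0^t k(T - s) G(psi s) ds <= int_0^t k(t - s) G(psi s) ds
    = psi t <= xs].  Hence [psi] solves the original equation.

    Uniqueness in L^2: the difference [w] of two solutions satisfies
    [|w| <= k * (m |w|)] with [m] in L^2.  By Cauchy-Schwarz
    [w^2 <= ||m||^2 (k^2 * w^2)]; multiplying by [e^(- beta t)] makes the mass of
    the kernel [k^2 e^(- beta s)] so small that Tonelli forces [w = 0]. *)

Set Implicit Arguments.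
Unset Strict Implicit.
Unset Printing Implicit Defensive.

Import Order.TTheory GRing.Theory Num.Theory.
Import numFieldNormedType.Exports.

Local Open Scope classical_set_scope.
Local Open Scope ring_scope.

(** * Integrals on the line *)

(** Translation preserves the length of half-open intervals, and Lebesgue measure is the only
    measure with those values. *)
Lemma lebesgue_measure_addr (R : realType) (a : R) (A : set R) : measurable A ->
  pushforward (@lebesgue_measure R) ((fun x => x + a) : _ -> measurableTypeR R) A
  = lebesgue_measure A.
Proof.
move=> mA; apply/esym.
have mphi : measurable_fun [set: measurableTypeR R]
    ((fun x => x + a) : measurableTypeR R -> measurableTypeR R).
  exact: measurable_funD.
pose m := measure_function_pushforward__canonical__measure_function_Measure
  (@lebesgue_measure R) mphi.
apply: (lebesgue_measure_unique (mu := m)) => //= _ [[c b]] _ <-/=.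
rewrite /m /= /pushforward (_ : _ @^-1` _ = `](c - a), (b - a)]%classic).
  rewrite !lebesgue_measure_itv/= !lte_fin ltrD2r; case: ifP => // _.
  by rewrite -!EFinB; congr EFin; ring.
by apply/seteqP; split => x/=; rewrite !in_itv/= ltrBlDr lerBrDr.
Qed.

Lemma ge0_integral_addr (R : realType) (f : R -> \bar R) (a : R) :
  measurable_fun [set: R] f -> (forall x, 0 <= f x)%E ->
  (\int[@lebesgue_measure R]_x f (x + a)%R = \int[@lebesgue_measure R]_x f x)%E.
Proof.
move=> mf f0.
have mphi : measurable_fun [set: measurableTypeR R]
    ((fun x => x + a) : measurableTypeR R -> measurableTypeR R).
  exact: measurable_funD.
rewrite -[LHS](@ge0_integral_pushforward _ _ (measurableTypeR R)
  (measurableTypeR R) R _ mphi (@lebesgue_measure R) setT f)//.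
apply: eq_measure_integral => //= A mA _.
exact: lebesgue_measure_addr.
Qed.

(** The map [x |-> a - x] is the reflection followed by a translation, and both preserve Lebesgue
    measure. *)
Lemma ge0_integral_subl (R : realType) (f : R -> \bar R) (a : R) :
  measurable_fun [set: R] f -> (forall x, 0 <= f x)%E ->
  (\int[@lebesgue_measure R]_x f (a - x)%R = \int[@lebesgue_measure R]_x f x)%E.
Proof.
move=> mf f0.
rewrite -[RHS](ge0_integral_addr a)//.
pose g (x : R) := f (x + a).
have mg : measurable_fun [set: R] g.
  by apply: measurableT_comp => //; exact: measurable_funD.
have mphi : measurable_fun [set: measurableTypeR R]
    (-%R : measurableTypeR R -> measurableTypeR R).
  exact: oppr_measurable.
rewrite [LHS](_ : _ = \int[@lebesgue_measure R]_x g (- x)%R)%E; last first.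
  by apply: eq_integral => x _; rewrite /g addrC.
rewrite -[LHS](@ge0_integral_pushforward _ _ (measurableTypeR R)
  (measurableTypeR R) R _ mphi (@lebesgue_measure R) setT g)//.
  by apply: eq_measure_integral => //= A mA _; exact: lebesgue_measureN.
by move=> y _; exact: f0.
Qed.

Lemma measurable_comp_subl (R : realType) (u : R -> R) (t : R) :
  measurable_fun [set: R] u -> measurable_fun [set: R] (fun s => u (t - s)).
Proof. by move=> meas_u; apply: measurableT_comp => //; exact: measurable_funB. Qed.

Lemma lebesgue_aeS (R : realType) (P Q : R -> Prop) :
  (forall x, P x -> Q x) ->
  {ae @lebesgue_measure R, forall x, P x} ->
  {ae @lebesgue_measure R, forall x, Q x}.
Proof. exact: (@filterS _ _ (ae_filter_ringOfSetsType (@lebesgue_measure R))). Qed.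

Lemma lebesgue_ae_forall (R : realType) (I : finType) (P : I -> R -> Prop) :
  (forall i, {ae @lebesgue_measure R, forall x, P i x}) ->
  {ae @lebesgue_measure R, forall x, forall i, P i x}.
Proof.
move=> H; exact: (@filter_forall _ _ _ _ (ae_filter_ringOfSetsType (@lebesgue_measure R)) H).
Qed.

(** Hölder's inequality with both exponents 2. The squared form in the extended reals allows
    infinite integrals on either side. *)
Lemma integral_cauchy_schwarz (R : realType) (f g : R -> R) :
  measurable_fun [set: R] f -> measurable_fun [set: R] g ->
  ((\int[@lebesgue_measure R]_x (`|f x * g x|)%:E) `^ 2 <=
   (\int[@lebesgue_measure R]_x ((f x) ^+ 2)%:E) *
   (\int[@lebesgue_measure R]_x ((g x) ^+ 2)%:E))%E.
Proof.
move=> mf mg.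
have h2 (h : R -> R) : (\int[@lebesgue_measure R]_x ((h x) ^+ 2)%:E =
    'N[@lebesgue_measure R]_(2%:E)[EFin \o h] `^ 2)%E.
  rewrite poweR_Lnorm//; apply: eq_integral => x _ /=.
  by rewrite powR_mulrn// -normrX ger0_norm ?sqr_ge0.
rewrite !h2 -poweRM ?Lnorm_ge0//.
have H : ('N[@lebesgue_measure R]_1[EFin \o (f \* g)%R] <=
    'N[@lebesgue_measure R]_(2%:E)[EFin \o f] *
    'N[@lebesgue_measure R]_(2%:E)[EFin \o g])%E.
  by apply: hoelder => //; lra.
rewrite Lnorm1 in H.
apply: gt0_ler_poweR => //; rewrite ?in_itv/= ?leey ?andbT.
  by apply: integral_ge0 => x _; rewrite lee_fin.
by rewrite mule_ge0 ?Lnorm_ge0.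
Qed.

(** * Convolution of nonnegative functions *)

Section convolution.
Variables (R : realType) (k f : R -> R).
Hypotheses (mk : measurable_fun [set: R] k) (mf : measurable_fun [set: R] f).
Hypotheses (k0 : forall x, 0 <= k x) (f0 : forall x, 0 <= f x).
Let mu := @lebesgue_measure R.

Let h (p : R * R) : \bar R := (k p.2 * f (p.1 - p.2))%:E.

Let mh : measurable_fun [set: R * R] h.
Proof.
apply/measurable_EFinP; apply: measurable_funM.
  by apply: measurableT_comp => //; exact: measurable_snd.
apply: measurableT_comp => //.
by apply: measurable_funB; [exact: measurable_fst|exact: measurable_snd].
Qed.

Lemma measurable_convolution :
  measurable_fun [set: R] (fun t => \int[mu]_s (k s * f (t - s))%:E)%E.
Proof.
apply: (@measurable_fun_fubini_tonelli_F _ _ (measurableTypeR R)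
  (measurableTypeR R) R mu h) => //.
by move=> p; rewrite lee_fin mulr_ge0.
Qed.

(** Tonelli exchanges the two integrals; translation invariance then makes the inner one independent
    of [s]. *)
Lemma integral_convolution :
  (\int[mu]_t \int[mu]_s (k s * f (t - s))%:E =
   (\int[mu]_s (k s)%:E) * (\int[mu]_t (f t)%:E))%E.
Proof.
rewrite (@fubini_tonelli _ _ (measurableTypeR R) (measurableTypeR R) R mu mu h)//;
  last by move=> p; rewrite lee_fin mulr_ge0.
rewrite -ge0_integralZr//; last 3 first.
- exact/measurable_EFinP.
- by move=> x _; rewrite lee_fin.
- by apply: integral_ge0 => x _; rewrite lee_fin.
apply: eq_integral => s _; rewrite /h /=.
under eq_integral do rewrite EFinM.
rewrite ge0_integralZl//.
- congr (_ * _)%E.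
  rewrite (@ge0_integral_addr R (EFin \o f) (- s))//.
  exact/measurable_EFinP.
- by apply/measurable_EFinP; apply: measurableT_comp => //; exact: measurable_funB.
- by move=> x _; rewrite lee_fin.
- by rewrite lee_fin.
Qed.

End convolution.

(** Dominated convergence along [beta = n]: the weighted integrand tends to 0 for every [s > 0] and
    is dominated by [|f|]. *)
Lemma exp_weight_lt (R : realType) (f : R -> R) (b e : R) :
  (@lebesgue_measure R).-integrable `[0, b] (EFin \o f) -> 0 < e ->
  exists2 beta : R, 0 <= beta &
    (`|\int[@lebesgue_measure R]_(s in `[0%R, b]) (f s * expR (- (beta * s)))%:E|
      < e%:E)%E.
Proof.
move=> intf e0; set mu := @lebesgue_measure R.
have mf : measurable_fun `[0, b] f by apply/measurable_EFinP; case/integrableP: intf.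
pose F (n : nat) s := (f s * expR (- (n%:R * s)))%:E.
have mF n : measurable_fun `[0, b] (F n).
  apply/measurable_EFinP; apply: measurable_funM => //.
  apply: measurableT_comp => //; apply: measurable_funN.
  exact: measurable_funM.
have [||||] := @dominated_convergence _ _ R mu _ (measurable_itv `[0, b])
    F (cst 0%E) (abse \o (EFin \o f)) mF.
- exact: measurable_cst.
(* At [s = 0] the weight is constantly 1, so this null point is excepted. *)
- exists [set 0]; split => //; first exact: lebesgue_measure_set1.
  move=> s /= /not_implyP[]; rewrite in_itv/= => /andP[s0 sb] H.
  apply: contrapT => sN0; apply: H.
  have {s0 sN0} s0 : 0 < s by rewrite lt_neqAle s0 andbT eq_sym; exact/eqP.
  apply: cvg_EFin; first by near=> n.
  rewrite -(mulr0 (f s)); apply: cvgMl_tmp => /=.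
  apply: (@cvg_comp _ _ _ (fun n : nat => n%:R * s) (fun x => expR (- x)) _ +oo%R).
    apply/cvgryPge => A; near=> n; rewrite -ler_pdivrMr//.
    by near: n; exact: nbhs_infty_ger.
  exact: cvgr_expR.
- exact: integrable_abse.
- apply: aeW => s n; rewrite /= in_itv/= => /andP[s0 sb].
  rewrite /= lee_fin normrM ler_piMr// ger0_norm ?expR_ge0//.
  by rewrite -expR0 ler_expR oppr_le0 mulr_ge0.
move=> _ _; rewrite integral0 => /fine_cvgP[Ffin /cvgr0_norm_lt/(_ _ e0) Flt].
near \oo => n; exists n%:R; first exact: ler0n.
have Fn : (\int[mu]_(x in `[0%R, b]) F n x)%E \is a fin_num by near: n.
by rewrite -(fineK Fn) abse_EFin lte_fin; near: n.
Unshelve. all: by end_near. Qed.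

(** The endpoint 0 is a null set. This allows a kernel to be exchanged for its restriction to the
    positive half-line. *)
Lemma eq_oc_integral (R : realType) (f g : R -> R) (t : R) :
  (forall s, 0 < s <= t -> f s = g s) ->
  (@lebesgue_measure R).-integrable `[0, t] (EFin \o f) ->
  (@lebesgue_measure R).-integrable `[0, t] (EFin \o g) /\
  \int[@lebesgue_measure R]_(s in `[0, t]) f s =
  \int[@lebesgue_measure R]_(s in `[0, t]) g s.
Proof.
move=> fg intf; set mu := @lebesgue_measure R.
have sub : `]0, t] `<=` `[0, t] by apply: subset_itvr; rewrite bnd_simp.
have intf' : mu.-integrable `]0, t] (EFin \o f) by exact: integrableS intf.
have fg' : {in `]0, t]%classic, EFin \o f =1 EFin \o g}.
  by move=> s; rewrite inE/= in_itv/= => st; rewrite (fg s).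
have intg' : mu.-integrable `]0, t] (EFin \o g).
  exact: (@eq_integrable _ _ _ mu _ (measurable_itv _) _ _ fg' intf').
have mf' : measurable_fun `]0, t] (EFin \o f) by case/integrableP: intf'.
have mg' : measurable_fun `]0, t] (EFin \o g) by case/integrableP: intg'.
split; last first.
  rewrite /Rintegral -[in LHS]integral_itv_obnd_cbnd// -[in RHS]integral_itv_obnd_cbnd//.
  by congr fine; apply: eq_integral.
apply/integrableP; split.
  exact/emeasurable_fun_itv_obnd_cbndP.
rewrite -integral_itv_obnd_cbnd; last exact: measurableT_comp.
by case/integrableP: intg'.
Qed.

Lemma Lnorm2_restrict_lty (R : realType) (D : set R) (f : R -> R) :
  ('N[@lebesgue_measure R]_(2%:E)[(EFin \o f) \_ D] < +oo)%E <->
  (\int[@lebesgue_measure R]_(x in D) ((f x) ^+ 2)%:E < +oo)%E.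
Proof.
have E : ('N[@lebesgue_measure R]_(2%:E)[(EFin \o f) \_ D] `^ 2 =
    \int[@lebesgue_measure R]_(x in D) ((f x) ^+ 2)%:E)%E.
  rewrite poweR_Lnorm// [RHS]integral_mkcond; apply: eq_integral => x _.
  rewrite !patchE; case: ifP => _ /=.
    by rewrite powR_mulrn// -normrX ger0_norm ?sqr_ge0.
  by rewrite normr0 powR0.
rewrite -E; split; first exact: poweR_lty.
exact: lty_poweRy.
Qed.

(** The integrand is at most [2 A^2 u^2 + 2 B^2], and the interval has finite length. It serves for
    the difference of two solutions and for the factor [m] multiplying it. *)
Lemma integral_affine_sqr_lty (R : realType) (u h : R -> R) (b A B : R) :
  measurable_fun `[0, b] u -> measurable_fun [set: R] h ->
  (forall x, `|h x| <= B) ->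
  (\int[@lebesgue_measure R]_(x in `[0%R, b]) ((u x) ^+ 2)%:E < +oo)%E ->
  (\int[@lebesgue_measure R]_(x in `[0%R, b]) ((A * u x + h x) ^+ 2)%:E < +oo)%E.
Proof.
move=> meas_u mh hB u2.
set mu := @lebesgue_measure R.
apply: (@le_lt_trans _ _ (\int[mu]_(x in `[0%R, b])
    ((2 * A ^+ 2)%:E * ((u x) ^+ 2)%:E + (2 * B ^+ 2)%:E))%E).
  apply: ge0_le_integral => //.
  - by move=> x _; rewrite lee_fin sqr_ge0.
  - apply/measurable_EFinP; apply: measurable_funX; apply: measurable_funD.
      exact: measurable_funM.
    exact: measurable_funTS.
  - apply: emeasurable_funD => //; apply: emeasurable_funM => //.
    by apply/measurable_EFinP; exact: measurable_funX.
  - move=> x _; rewrite -EFinM -EFinD lee_fin.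
    have : h x ^+ 2 <= B ^+ 2.
      by rewrite -real_normK ?num_real// ler_sqr ?nnegrE// (le_trans _ (hB x)).
    by have := sqr_ge0 (A * u x - h x); nra.
rewrite ge0_integralD//.
- rewrite ge0_integralZl//.
  + rewrite integral_cst//= lebesgue_measure_itv/= lte_add_pinfty//.
      by rewrite lte_mul_pinfty// lee_fin mulr_ge0// sqr_ge0.
    by case: ifP => _; rewrite -?EFinB -?EFinM ?mule0 ltry.
  + by apply/measurable_EFinP; exact: measurable_funX.
  + by move=> x _; rewrite lee_fin sqr_ge0.
  + by rewrite lee_fin mulr_ge0// sqr_ge0.
- move=> x _; rewrite -EFinM lee_fin; apply: mulr_ge0; last exact: sqr_ge0.
  by apply: mulr_ge0 => //; exact: sqr_ge0.
- by apply: emeasurable_funM => //; apply/measurable_EFinP; exact: measurable_funX.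
- by move=> x _; rewrite lee_fin mulr_ge0// sqr_ge0.
Qed.

(** * The quadratic nonlinearity *)

(** The last bound says that the derivative of the quadratic is nonpositive at [xs]: on [[0, xs]]
    the slope lies between [lam] and 0. *)
Lemma quadratic_small_root (R : realType) (a lam c : R) :
  0 <= a -> lam < 0 -> 0 <= c -> 0 < lam ^+ 2 - 4 * a * c ->
  exists xs : R, [/\ 0 <= xs, a * xs ^+ 2 + lam * xs + c = 0
                   & 2 * a * xs <= - lam].
Proof.
move=> a0 lam0 c0 D0; pose r := Num.sqrt (lam ^+ 2 - 4 * a * c).
have r0 : 0 < r by rewrite sqrtr_gt0.
have r2 : r ^+ 2 = lam ^+ 2 - 4 * a * c by rewrite sqr_sqrtr// ltW.
have rl : 0 < r - lam by lra.
have rlN0 : r - lam != 0 by rewrite gt_eqF.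
(* This form of the smallest root remains valid for [a = 0]. *)
exists (2 * c / (r - lam)); split.
- by rewrite divr_ge0 ?mulr_ge0// ltW.
- have -> : a * (2 * c / (r - lam)) ^+ 2 + lam * (2 * c / (r - lam)) + c =
    c * (4 * a * c - lam ^+ 2 + r ^+ 2) / (r - lam) ^+ 2 by field.
  by rewrite r2; field.
- rewrite (_ : 2 * a * (2 * c / (r - lam)) = (4 * a * c) / (r - lam)); last by field.
  rewrite ler_pdivrMr//; have -> : 4 * a * c = lam ^+ 2 - r ^+ 2 by lra.
  by rewrite subr_sqr; nra.
Qed.

Definition clamp (R : realType) (b x : R) : R := Num.max 0 (Num.min x b).

Lemma clamp_itv (R : realType) (b x : R) : 0 <= b -> 0 <= clamp b x <= b.
Proof. by move=> b0; rewrite /clamp le_max lexx ge_max b0 ge_min lexx orbT. Qed.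

Lemma clamp_id (R : realType) (b x : R) : 0 <= x <= b -> clamp b x = x.
Proof. by move=> /andP[x0 xb]; rewrite /clamp (min_idPl xb) (max_idPr x0). Qed.

Lemma clamp_ge (R : realType) (b x : R) : 0 <= b -> b <= x -> clamp b x = b.
Proof. by move=> b0 bx; rewrite /clamp (min_idPr bx) (max_idPr b0). Qed.

Lemma clamp_lipschitz (R : realType) (b x y : R) :
  `|clamp b x - clamp b y| <= `|x - y|.
Proof.
have h1 := ler_norm (x - y).
have := ler_norm (y - x); rewrite distrC => h2.
have h0 := normr_ge0 (x - y).
rewrite /clamp ler_norml.
case: (leP x b) => ?; case: (leP y b) => ?;
  case: (leP 0 x) => ?; case: (leP 0 y) => ?; case: (leP 0 b) => ?;
  apply/andP; split; lra.
Qed.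

Lemma measurable_clamp (R : realType) (b : R) : measurable_fun [set: R] (clamp b).
Proof.
by apply: measurable_maxr => //; exact: measurable_minr.
Qed.

(** On [[0, xs]] the slope is at most [- lam] in absolute value and the quadratic decreases to 0 at
    [xs], which gives both the Lipschitz constant [- lam] and the bound [- lam * xs]. *)
Lemma quadratic_clamp (R : realType) (a lam c xs : R) :
  0 <= a -> 0 <= xs -> a * xs ^+ 2 + lam * xs + c = 0 -> 2 * a * xs <= - lam ->
  let G x := a * clamp xs x ^+ 2 + lam * clamp xs x + c in
  [/\ measurable_fun [set: R] G, (forall x, 0 <= G x <= - lam * xs),
      (forall x, xs <= x -> G x = 0),
      (forall x, 0 <= x <= xs -> G x = a * x ^+ 2 + lam * x + c)
    & forall x y, `|G x - G y| <= - lam * `|x - y|].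
Proof.
move=> a0 xs0 Fxs axs G; split.
- rewrite /G; apply: measurable_funD => //; apply: measurable_funD.
    by apply: measurable_funM => //; apply: measurable_funX; exact: measurable_clamp.
  by apply: measurable_funM => //; exact: measurable_clamp.
- move=> x; rewrite /G; have := clamp_itv x xs0.
  move: (clamp xs x) => y /andP[y0 yxs].
  (* The root [xs] is factored out; the second factor lies in [[0, - lam]]. *)
  have -> : a * y ^+ 2 + lam * y + c = (xs - y) * (- lam - a * (xs + y)) by nra.
  have h1 : a * (xs + y) <= 2 * a * xs by nra.
  have h2 : 0 <= a * (xs + y) by nra.
  by apply/andP; split; nra.
- by move=> x xsx; rewrite /G clamp_ge.
- by move=> x xxs; rewrite /G clamp_id.
- move=> x y; rewrite /G; apply: le_trans (_ : - lam * `|clamp xs x - clamp xs y| <= _).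
    move: (clamp_itv x xs0) (clamp_itv y xs0).
    move: (clamp xs x) (clamp xs y) => {}x {}y /andP[x0 xx] /andP[y0 yx].
    have -> : a * x ^+ 2 + lam * x + c - (a * y ^+ 2 + lam * y + c) =
      - ((- lam - a * (x + y)) * (x - y)) by ring.
    have h1 : a * (x + y) <= 2 * a * xs by nra.
    have h2 : 0 <= a * (x + y) by nra.
    by rewrite normrN normrM ler_wpM2r// ger0_norm; lra.
  by apply: ler_wpM2l; [nra|exact: clamp_lipschitz].
Qed.

(** * Existence *)

Section bounded_volterra.
Variables (R : realType) (k G : R -> R) (C L : R).
Local Notation mu := (@lebesgue_measure R).
Hypotheses (mk : measurable_fun [set: R] k) (k0 : forall x, 0 <= k x).
Hypothesis ik : forall b, mu.-integrable `[0, b] (EFin \o k).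
Hypotheses (mG : measurable_fun [set: R] G) (GC : forall x, 0 <= G x <= C).
Hypotheses (L0 : 0 <= L) (GL : forall x y, `|G x - G y| <= L * `|x - y|).

Lemma integrable_kernel_mul (h : R -> R) (M t : R) :
  measurable_fun [set: R] h -> (forall x, 0 <= x <= t -> `|h x| <= M) ->
  mu.-integrable `[0, t] (EFin \o (fun s => k s * h s)).
Proof.
move=> mh hM; apply: (@le_integrable _ _ _ mu _ _ _ (fun s => (`|M| * k s)%:E)) => //.
- by apply/measurable_EFinP; apply: measurable_funTS; exact: measurable_funM.
- move=> s; rewrite /= in_itv/= => st; rewrite lee_fin !normrM normr_id mulrC.
  by rewrite ler_wpM2r// (le_trans (hM _ st))// ler_norm.
- rewrite (_ : (fun s => _) = (fun s => `|M|%:E * (EFin \o k) s)%E)//.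
  exact: integrableZl.
Qed.

Definition volterra_op (u : R -> R) (t : R) : R :=
  \int[mu]_(s in `[0, t]) (k s * G (u (t - s))).

Lemma integrable_volterra (u : R -> R) (t : R) : measurable_fun [set: R] u ->
  mu.-integrable `[0, t] (EFin \o (fun s => k s * G (u (t - s)))).
Proof.
move=> meas_u; apply: (@integrable_kernel_mul _ C).
  by apply: measurableT_comp => //; exact: measurable_comp_subl.
by move=> x _; have /andP[? ?] := GC (u (t - x)); rewrite ger0_norm.
Qed.

(** Extending [k] and [G \o u] by zero to negative arguments turns the integral over [[0, t]] into a
    convolution on the whole line, whose measurability comes from Tonelli. *)
Lemma measurable_volterra_op (u : R -> R) : measurable_fun [set: R] u ->
  measurable_fun [set: R] (volterra_op u).
Proof.
move=> meas_u.
pose k' := k \_ `[0, +oo[%classic; pose f' := (G \o u) \_ `[0, +oo[%classic.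
have m' (h : R -> R) : measurable_fun [set: R] h ->
    measurable_fun [set: R] (h \_ `[0, +oo[%classic).
  move=> mh; apply/(measurable_restrictT _ _).1 => //.
  exact: measurable_funS mh.
have -> : volterra_op u = fine \o (fun t => \int[mu]_s (k' s * f' (t - s))%:E)%E.
  apply/funext => t; rewrite /volterra_op /Rintegral /=; congr fine.
  rewrite integral_mkcond; apply: eq_integral => s _.
  rewrite /k' /f' !patchE !mem_setE !in_itv/= !andbT subr_ge0.
  by case: (leP 0 s) => s0 /=; case: (leP s t) => st /=; rewrite ?mulr0 ?mul0r.
apply: measurableT_comp => //; apply: measurable_convolution.
- exact: m'.
- by apply: m'; exact: measurableT_comp.
- by move=> x; rewrite /k' patchE; case: ifP.
- by move=> x; rewrite /f' patchE; case: ifP => //= _; case/andP: (GC (u x)).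
Qed.

Lemma volterra_op_ge0 u t : 0 <= volterra_op u t.
Proof. by apply: Rintegral_ge0 => s _; rewrite mulr_ge0//; case/andP: (GC (u (t - s))). Qed.

Lemma volterra_op_lt0 u t : t < 0 -> volterra_op u t = 0.
Proof.
by move=> t0; rewrite /volterra_op set_itv_ge ?Rintegral_set0// bnd_simp -ltNge.
Qed.

Lemma volterra_op_le u b t : measurable_fun [set: R] u -> t <= b ->
  volterra_op u t <= C * \int[mu]_(s in `[0, b]) k s.
Proof.
move=> meas_u tb.
have C0 : 0 <= C by have /andP[] := GC 0; exact: le_trans.
have ikt := ik t.
apply: (@le_trans _ _ (\int[mu]_(s in `[0, t]) (C * k s))).
  apply: le_Rintegral => //.
  - exact: integrable_volterra.
  - exact: (integrableZl _ C ikt).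
  - by move=> s _; rewrite mulrC ler_wpM2r//; case/andP: (GC (u (t - s))).
rewrite RintegralZl//; apply: ler_wpM2l => //.
rewrite -lee_fin !fineK; [|exact: integrable_fin_num..].
apply: ge0_subset_integral => //.
- by apply/measurable_EFinP; exact: measurable_funTS.
- by move=> x _; rewrite lee_fin.
- by apply: subset_itvl; rewrite bnd_simp.
Qed.

(** In the weighted sup norm the operator has Lipschitz constant [L * kap], since the factor
    [e^(beta (t - s))] splits into [e^(beta t)] and the damping [e^(- beta s)] of the kernel. *)
Lemma volterra_op_contract (u v : R -> R) (b beta M kap : R) :
  measurable_fun [set: R] u -> measurable_fun [set: R] v ->
  0 <= beta -> 0 <= M ->
  \int[mu]_(s in `[0, b]) (k s * expR (- (beta * s))) <= kap ->
  (forall t, 0 <= t <= b -> `|u t - v t| <= M * expR (beta * t)) ->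
  forall t, 0 <= t <= b ->
  `|volterra_op u t - volterra_op v t| <= L * kap * M * expR (beta * t).
Proof.
move=> meas_u mv beta0 M0 kk uv t /andP[t0 tb].
have ie b' : mu.-integrable `[0, b'] (EFin \o (fun s => k s * expR (- (beta * s)))).
  apply: (@integrable_kernel_mul _ 1).
    apply: measurableT_comp => //; apply: measurable_funN.
    exact: measurable_funM.
  move=> x /andP[x0 _]; rewrite ger0_norm ?expR_ge0// -expR0 ler_expR.
  by rewrite oppr_le0 mulr_ge0.
have iu := integrable_volterra t meas_u; have iv := integrable_volterra t mv.
rewrite /volterra_op -RintegralB//.
apply: (le_trans (le_normr_Rintegral _ _)) => //.
  exact: (integrableB _ iu iv).
apply: (@le_trans _ _ (\int[mu]_(s in `[0, t])
    (L * M * expR (beta * t) * (k s * expR (- (beta * s)))))).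
  apply: le_Rintegral => //.
  - exact: (integrable_norm (integrableB _ iu iv)).
  - exact: (integrableZl _ (L * M * expR (beta * t)) (ie t)).
  - move=> s; rewrite /= in_itv/= => /andP[s0 st].
    rewrite -mulrBr normrM (ger0_norm (k0 s)).
    rewrite (_ : L * M * _ * _ =
      k s * (L * (M * expR (beta * (t - s))))); last first.
      by rewrite mulrBr expRD; ring.
    apply: ler_wpM2l => //; apply: (le_trans (GL _ _)); apply: ler_wpM2l => //.
    by apply: uv; rewrite subr_ge0 st lerBlDr (le_trans tb)// lerDl.
rewrite RintegralZl//.
rewrite (_ : L * kap * M * _ = L * M * expR (beta * t) * kap); last by ring.
apply: ler_wpM2l; first by rewrite !mulr_ge0// expR_ge0.
apply: le_trans kk.
rewrite -lee_fin !fineK; [|exact: integrable_fin_num..].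
apply: ge0_subset_integral => //.
- by case/integrableP: (ie b).
- by move=> x _; rewrite lee_fin mulr_ge0// expR_ge0.
- by apply: subset_itvl; rewrite bnd_simp.
Qed.

End bounded_volterra.

(** * Picard iteration *)

Section picard.
Variables (R : realType) (k G : R -> R) (C L : R).
Local Notation mu := (@lebesgue_measure R).
Hypotheses (mk : measurable_fun [set: R] k) (k0 : forall x, 0 <= k x).
Hypothesis ik : forall b, mu.-integrable `[0, b] (EFin \o k).
Hypotheses (mG : measurable_fun [set: R] G) (GC : forall x, 0 <= G x <= C).
Hypotheses (L0 : 0 <= L) (GL : forall x y, `|G x - G y| <= L * `|x - y|).
Let Phi := volterra_op k G.
Let u n := iter n Phi (fun=> 0).

Let meas_u n : measurable_fun [set: R] (u n).
Proof. by elim: n => [|n IH]; [exact: measurable_cst|exact: measurable_volterra_op IH]. Qed.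

Let picard_step (b : R) : exists2 M : R, 0 <= M &
  forall n t, 0 <= t <= b -> `|u n.+1 t - u n t| <= geometric M 2^-1 n.
Proof.
have [beta beta0] : exists2 beta, 0 <= beta &
    (* This mass makes the contraction factor at most [L / (2 (L + 1)) <= 1/2]; using [L + 1] covers
       the case [L = 0]. *)
    \int[mu]_(s in `[0, b]) (k s * expR (- (beta * s))) <= (2 * (L + 1))^-1.
  have L1 : 0 < (2 * (L + 1))^-1 by rewrite invr_gt0 mulr_gt0// ltr_wpDl.
  have [beta beta0 H] := exp_weight_lt (ik b) L1.
  exists beta => //; rewrite /Rintegral; move: H.
  case: (integral _ _ _) => [r||] //=; rewrite lte_fin => /ltW.
  exact: le_trans (ler_norm _).
move=> kap; have C0 : 0 <= C by have /andP[] := GC 0; exact: le_trans.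
set I := \int[mu]_(s in `[0, b]) k s.
have I0 : 0 <= I by apply: Rintegral_ge0.
(* [C * I] bounds the first iterate, and [e^(beta b)] converts the weighted norm into the plain sup
   norm on [[0, b]]. *)
exists (C * I * expR (beta * b)); first by rewrite !mulr_ge0 ?expR_ge0.
suff H n t : 0 <= t <= b ->
    `|u n.+1 t - u n t| <= C * I * 2^-1 ^+ n * expR (beta * t).
  move=> n t /andP[t0 tb]; apply: (le_trans (H _ _ _)); first by rewrite t0.
  rewrite /geometric /= mulrAC; apply: ler_wpM2r; first by rewrite exprn_ge0.
  by apply: ler_wpM2l; rewrite ?mulr_ge0// ler_expR ler_wpM2l.
elim: n t => [|n IH] t /andP[t0 tb].
  rewrite /u /= subr0 ger0_norm; last exact: volterra_op_ge0 k0 GC _ _.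
  apply: (le_trans (volterra_op_le mk k0 ik mG GC _ tb)) => //.
  by rewrite mulr1 ler_peMr ?mulr_ge0// -expR0 ler_expR mulr_ge0.
have M0 : 0 <= C * I * 2^-1 ^+ n by rewrite !mulr_ge0// exprn_ge0.
have := volterra_op_contract mk k0 ik mG GC L0 GL (meas_u n.+1) (meas_u n) beta0 M0 kap IH.
move=> /(_ t); rewrite t0 tb => /(_ isT) /le_trans; apply.
apply: ler_wpM2r; first exact: expR_ge0.
rewrite exprS (_ : L * _ * _ = (C * I * 2^-1 ^+ n) * (L / (2 * (L + 1)))); last by ring.
rewrite [leRHS](_ : _ = (C * I * 2^-1 ^+ n) * 2^-1); last by ring.
apply: ler_wpM2l => //.
rewrite ler_pdivrMr ?mulr_gt0 ?ltr_wpDl// mulrA mulVf// mul1r.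
by rewrite lerDl.
Qed.

(** The increments decay geometrically, so the iterates converge pointwise. Dominated convergence
    with majorant [C * k] carries the limit through the integral at every [t]. *)
Lemma volterra_op_fixpoint : exists2 psi : R -> R,
  measurable_fun [set: R] psi & forall t, psi t = volterra_op k G psi t.
Proof.
have cu t : cvgn (u^~ t).
  have [t0|t0] := ltP t 0.
    have -> : u^~ t = fun=> 0.
      by apply/funext => -[|n] //; rewrite /u /= /Phi volterra_op_lt0.
    exact: is_cvg_cst.
  have [M M0 H] := picard_step t.
  (* The iterates are partial sums of their increments, a series dominated by a geometric one. *)
  have -> : u^~ t = fun n => u 0%N t + series (telescope (u^~ t)) n.
    by apply/funext => n; rewrite -eq_sum_telescope.
  apply: is_cvgD; first exact: is_cvg_cst.
  apply: normed_cvg.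
  apply: (@series_le_cvg _ _ (geometric M 2^-1)).
  - by move=> n; exact: normr_ge0.
  - by move=> n; rewrite geometric_ge0.
  - by move=> n; apply: H; rewrite t0 lexx.
  - by apply: is_cvg_geometric_series; rewrite ger0_norm// invf_lt1// ltr1n.
pose psi t := limn (u^~ t).
have upsi t : u n t @[n --> \oo] --> psi t by exact: cu.
have mpsi : measurable_fun [set: R] psi.
  by apply: (measurable_fun_cvg meas_u) => t _; exact: upsi.
exists psi => // t.
have C0 : 0 <= C by have /andP[] := GC 0; exact: le_trans.
have iC : mu.-integrable `[0, t] (fun s => (C * k s)%:E) by exact: (integrableZl _ C (ik t)).
have mk' (v : R -> R) : measurable_fun [set: R] v ->
    measurable_fun `[0, t] (fun s => (k s * G (v (t - s)))%:E).
  by move=> mv; case/integrableP: (integrable_volterra mk ik mG GC t mv).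
have H : (\int[mu]_(s in `[0%R, t]) (k s * G (u n (t - s)))%:E)%E @[n --> \oo] -->
    (\int[mu]_(s in `[0%R, t]) (k s * G (psi (t - s)))%:E)%E.
  have [|||_ _] := @dominated_convergence _ _ R mu _ (measurable_itv `[0, t])
    (fun n s => (k s * G (u n (t - s)))%:E) (fun s => (k s * G (psi (t - s)))%:E)
    (fun s => (C * k s)%:E) (fun n => mk' _ (meas_u n)) (mk' _ mpsi); last by apply.
  - apply: aeW => s _; apply: cvg_EFin; first by near=> n.
    apply: cvgMl_tmp.
    apply/cvgrPdist_le => e e0; near=> n.
    apply: (le_trans (GL _ _)); apply: (@le_trans _ _ ((L + 1) * (e / (L + 1)))).
      apply: ler_pM => //; first by rewrite lerDl.
      near: n; move/cvgrPdist_le: (upsi (t - s)); apply.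
      by rewrite divr_gt0// ltr_wpDl.
    by rewrite mulrC divfK// gt_eqF// ltr_wpDl.
  - by [].
  - apply: aeW => s n _; rewrite lee_fin normrM mulrC (ger0_norm (k0 s)).
    by rewrite ler_wpM2r//; have /andP[? ?] := GC (u n (t - s)); rewrite ger0_norm.
(* Both sides of the equation are limits of the shifted sequence [u n.+1 t]. *)
apply: (@cvg_unique _ (@Rhausdorff R) (u n.+1 t @[n --> \oo])).
  have := upsi t; rewrite -(cvg_shiftS (u^~ t)); exact.
apply: fine_cvg; rewrite fineK//.
exact: integrable_fin_num (integrable_volterra mk ik mG GC t mpsi).
Unshelve. all: by end_near. Qed.

End picard.

(** * Upper bound of the solution by the root *)

Section comparison.
Variables (R : realType) (k G : R -> R) (C xs : R).
Local Notation mu := (@lebesgue_measure R).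
Hypotheses (mk : measurable_fun [set: R] k) (k0 : forall x, 0 <= k x).
Hypothesis k_nincr : forall s s', 0 < s -> s <= s' -> k s' <= k s.
Hypothesis ik : forall b, mu.-integrable `[0, b] (EFin \o k).
Hypotheses (mG : measurable_fun [set: R] G) (GC : forall x, 0 <= G x <= C).
Hypotheses (xs0 : 0 <= xs) (G_eq0 : forall x, xs <= x -> G x = 0).

Lemma volterra_solution_le (psi : R -> R) : measurable_fun [set: R] psi ->
  (forall t, psi t = volterra_op k G psi t) -> forall t, psi t <= xs.
Proof.
move=> mpsi psiE T; rewrite leNgt; apply/negP => psiT.
have C0 : 0 <= C by have /andP[] := GC 0; exact: le_trans.
have [T0|T0] := ltP T 0.
  by move: psiT; rewrite psiE volterra_op_lt0// ltNge xs0.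
have psi_int t : (psi t)%:E = (\int[mu]_(s in `[0%R, t]) (k s * G (psi (t - s)))%:E)%E.
  rewrite {1}psiE fineK//.
  exact: integrable_fin_num (integrable_volterra mk ik mG GC t mpsi).
pose A := [set t | 0 <= t <= T /\ psi t <= xs].
have A0 : A 0.
  split; first by rewrite lexx.
  by rewrite psiE /volterra_op set_itv1 Rintegral_set1.
have supA : has_sup A by split; [exists 0 | exists T => t -[/andP[]]].
pose t := sup A.
have tT : t <= T by apply: ge_sup => [|x []/andP[]//]; exists 0.
pose a := T - t.
have a0 : 0 <= a by rewrite subr_ge0.
(* Chosen so that [C * e < psi T - xs], which the final estimate contradicts. *)
pose e := (psi T - xs) / (C + 1).
have e0 : 0 < e by rewrite divr_gt0 ?subr_gt0// ltr_wpDl.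
(* [psi] is not known to be continuous, so the supremum [t] of the good times
   need not be good; a good time [tn] close to [t] is used instead, and the
   error is the mass of [k] just to the right of [a = T - t]. *)
have [c ac Hc] : exists2 c, a < c & \int[mu]_(s in `[a, c]) k s < e.
  have a1 : a < a + 1 by rewrite ltrDl.
  have ika : mu.-integrable `[a, (a + 1)] (EFin \o k).
    apply: integrableS (ik (a + 1)) => //.
    by apply: subset_itvr; rewrite bnd_simp.
  have H := parameterized_integral_near_left a1 e0 ika.
  near a^'+ => c; exists c => //.
  apply: (le_lt_trans (ler_norm _)).
  have : a <= c by apply: ltW; near: c; exact: nbhs_right_gt.
  near: c; apply: cvg_within; exact: H.
have [tn [/andP[tn0 tnT] psitn] tnt] : exists2 tn, A tn & t - (c - a) < tn.
  by apply: sup_adherent => //; rewrite subr_gt0.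
have tntl : tn <= t by apply: ub_le_sup; [case: supA|split; rewrite ?tn0].
pose p := T - tn.
have ap : a <= p by rewrite lerD2l lerN2.
have pc : p < c by rewrite /p; move: tnt; rewrite /a; lra.
(* The integral for [psi T] is cut at [a] and [p]: it vanishes before [a], [F1] dominates it on
   [[a, p]], and [F2] is the rest, to be compared with [psi tn]. *)
pose F1 := (fun s => (C * k s)%:E) \_ `[a, c].
pose F2 := (fun s => (k s * G (psi (T - s)))%:E) \_ `]p, T].
have mkG x (D : set R) : measurable D ->
    measurable_fun [set: R] ((fun s => (k s * G (psi (x - s)))%:E) \_ D).
  move=> mD; apply/(measurable_restrictT _ _).1 => //.
  apply: measurable_funTS; apply/measurable_EFinP; apply: measurable_funM => //.
  by apply: measurableT_comp => //; exact: measurable_comp_subl.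
have kG0 x (D : set R) s : (0 <= ((fun s => (k s * G (psi (x - s)))%:E) \_ D) s)%E.
  rewrite patchE; case: ifP => // _; rewrite lee_fin mulr_ge0//.
  by case/andP: (GC (psi (x - s))).
have mF1 : measurable_fun [set: R] F1.
  apply/(measurable_restrictT _ _).1 => //.
  by apply: measurable_funTS; apply/measurable_EFinP; exact: measurable_funM.
have F10 s : (0 <= F1 s)%E.
  by rewrite /F1 patchE; case: ifP => // _; rewrite lee_fin mulr_ge0.
have F20 s : (0 <= F2 s)%E by exact: kG0.
have mF2 : measurable_fun [set: R] F2 by exact: mkG.
have F12 : ((psi T)%:E <= \int[mu]_s F1 s + \int[mu]_s F2 s)%E.
  rewrite psi_int integral_mkcond -ge0_integralD//.
  apply: ge0_le_integral => //.
  - exact: mkG.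
  - exact: emeasurable_funD.
  move=> s _; rewrite [leLHS]patchE mem_setE in_itv/=.
  case: ifPn => [/andP[s0 sT]|_]; last by rewrite adde_ge0.
  have [ps|sp] := ltP p s.
    by rewrite [F2 s]patchE mem_setE in_itv/= ps sT leeDr.
  apply: (@le_trans _ _ (F1 s)); last by rewrite leeDl.
  rewrite [F1 s]patchE mem_setE in_itv/= (le_trans sp (ltW pc)) andbT.
  case: (leP a s) => as_.
    by rewrite lee_fin mulrC ler_wpM2r//; case/andP: (GC (psi (T - s))).
  (* Here [T - s] exceeds the supremum [t], so [psi (T - s)] is above [xs]. *)
  rewrite G_eq0 ?mulr0//; rewrite leNgt; apply/negP => psixs.
  have : T - s <= t.
    apply: ub_le_sup; first by case: supA.
    by split; [rewrite subr_ge0 sT gerBl s0|exact: ltW].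
  by move: as_; rewrite /a; lra.
have F23 : (\int[mu]_s F2 s <= (psi tn)%:E)%E.
  (* Shifting by [p] turns the kernel into [k (s + p)], which is at most [k s] by monotonicity. *)
  rewrite psi_int -(@ge0_integral_addr _ F2 p)//.
  rewrite [leRHS]integral_mkcond; apply: ge0_le_integral => //.
  - by apply: measurableT_comp => //; exact: measurable_funD.
  - exact: mkG.
  move=> s _; rewrite [leLHS]patchE mem_setE in_itv/= ltrDr -lerBrDr.
  have -> : T - p = tn by rewrite /p; lra.
  have -> : T - (s + p) = tn - s by rewrite /p; lra.
  case: ifPn => [/andP[s0 stn]|_]; last exact: (kG0 tn).
  rewrite patchE mem_setE in_itv/= (ltW s0) stn lee_fin ler_wpM2r//.
    by case/andP: (GC (psi (tn - s))).
  by apply: k_nincr => //; rewrite lerDl subr_ge0.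
have F1e : (\int[mu]_s F1 s = (C * \int[mu]_(s in `[a, c]) k s)%:E)%E.
  rewrite -integral_mkcond.
  have ikac : mu.-integrable `[a, c] (EFin \o k).
    by apply: integrableS (ik c) => //; apply: subset_itvr; rewrite bnd_simp.
  rewrite -RintegralZl// fineK//.
  exact: integrable_fin_num (integrableZl _ C ikac).
have : ((psi T)%:E <= (C * \int[mu]_(s in `[a, c]) k s)%:E + (psi tn)%:E)%E.
  by apply: (le_trans F12); rewrite F1e leeD2l.
rewrite -EFinD lee_fin => H.
have I0 : 0 <= \int[mu]_(s in `[a, c]) k s by apply: Rintegral_ge0.
have C1 : 0 < C + 1 by rewrite ltr_wpDl.
move: Hc H psitn I0; rewrite /e ltr_pdivlMr//.
by move: (Rintegral _ _ _) (psi T) (psi tn) (C) (xs) => I y z C' x; lra.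
Unshelve. all: by end_near. Qed.

End comparison.

Lemma quadratic_volterra_solution (R : realType) (k : R -> R) (a lam c : R) :
  let Q x := a * x ^+ 2 + lam * x + c in
  measurable_fun [set: R] k -> (forall x, 0 <= k x) ->
  (forall s s', 0 < s -> s <= s' -> k s' <= k s) ->
  (forall b, (@lebesgue_measure R).-integrable `[0, b] (EFin \o k)) ->
  0 <= a -> lam < 0 -> 0 <= c -> 0 < lam ^+ 2 - 4 * a * c ->
  exists (psi : R -> R) (xs : R), [/\ measurable_fun [set: R] psi,
    forall t, 0 <= psi t <= xs &
    forall t, (@lebesgue_measure R).-integrable `[0, t]
        (EFin \o (fun s => k s * Q (psi (t - s)))) /\
      psi t = \int[@lebesgue_measure R]_(s in `[0, t]) (k s * Q (psi (t - s)))].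
Proof.
move=> Q mk k0 kn ik a0 lam0 c0 D0.
have [xs [xs0 Qxs axs]] := quadratic_small_root a0 lam0 c0 D0.
have [mG GC G_eq0 GQ GL] := quadratic_clamp a0 xs0 Qxs axs.
set G := (fun x => _) in mG GC G_eq0 GQ GL.
have L0 : 0 <= - lam by rewrite oppr_ge0 ltW.
have [psi mpsi psiE] := volterra_op_fixpoint mk k0 ik mG GC L0 GL.
have psib t : 0 <= psi t <= xs.
  rewrite (volterra_solution_le mk k0 kn ik mG GC xs0 G_eq0 mpsi psiE) andbT.
  by rewrite psiE; exact: volterra_op_ge0 k0 GC _ _.
exists psi, xs; split=> // t.
have E : (fun s => k s * Q (psi (t - s))) = (fun s => k s * G (psi (t - s))).
  by apply/funext => s; rewrite [G _]GQ.
rewrite E; split; first exact: (@integrable_volterra R k G (- lam * xs) mk ik mG GC psi t mpsi).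
exact: psiE.
Qed.

(** * Uniqueness *)

(** Here [f * q <= 1/2], hence [z <= z / 2]. In the application [f] is the squared norm of [m], [q]
    the weighted mass of [k^2], and [z] the weighted squared norm of [w]. *)
Lemma contraction_eq0 (R : realType) (f q z : R) : 0 <= f -> 0 <= q -> 0 <= z ->
  q * (2 * (f + 1)) < 1 -> z <= f * (q * z) -> z = 0.
Proof.
move=> f0 q0 z0 qf zle; apply/eqP; rewrite eq_le z0 andbT.
have fq : f * q <= 1 / 2 by lra.
have : f * q * z <= 1 / 2 * z by rewrite ler_wpM2r.
by move: zle; rewrite mulrA; lra.
Qed.

Section uniqueness.
Variables (R : realType) (k : R -> R) (b : R).
Local Notation mu := (@lebesgue_measure R).
Hypothesis mk : measurable_fun [set: R] k.
Hypothesis k_lt0 : forall x, x < 0 -> k x = 0.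
Hypothesis ik2 : mu.-integrable `[0, b] (EFin \o (fun s => k s ^+ 2)).

Lemma convolution_ineq_eq0 (m w : R -> R) :
  measurable_fun [set: R] m -> measurable_fun [set: R] w ->
  (forall t, ~~ (0 <= t <= b) -> w t = 0) ->
  (\int[mu]_t ((m t) ^+ 2)%:E < +oo)%E ->
  (\int[mu]_t ((w t) ^+ 2)%:E < +oo)%E ->
  {ae mu, forall t, 0 <= t <= b ->
     ((`|w t|)%:E <= \int[mu]_s (`|m (t - s) * (k s * w (t - s))|)%:E)%E} ->
  {ae mu, forall t, w t = 0}.
Proof.
move=> mm mw w0 m2 w2 wle.
set M := (\int[mu]_t ((m t) ^+ 2)%:E)%E in m2.
have M0 : (0 <= M)%E by apply: integral_ge0 => x _; rewrite lee_fin sqr_ge0.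
have Mfin : M \is a fin_num by rewrite ge0_fin_numE.
have e0 : 0 < (2 * (fine M + 1))^-1.
  by rewrite invr_gt0 mulr_gt0// ltr_wpDl// fine_ge0.
have [beta beta0 kap] := exp_weight_lt ik2 e0.
pose kk := (fun s => k s ^+ 2 * expR (- (beta * s))) \_ `[0, b].
pose Z t := w t ^+ 2 * expR (- (beta * t)).
have me : measurable_fun [set: R] (fun s => expR (- (beta * s))).
  apply: measurableT_comp => //; apply: measurable_funN; exact: measurable_funM.
have mkk : measurable_fun [set: R] kk.
  apply/(measurable_restrictT _ _).1 => //; apply: measurable_funTS.
  by apply: measurable_funM => //; exact: measurable_funX.
have mZ : measurable_fun [set: R] Z.
  by apply: measurable_funM => //; exact: measurable_funX.
have kk0 s : 0 <= kk s.
  by rewrite /kk patchE; case: ifP => // _; rewrite mulr_ge0 ?sqr_ge0 ?expR_ge0.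
have Z0 t : 0 <= Z t by rewrite mulr_ge0 ?sqr_ge0 ?expR_ge0.
pose cv t := (\int[mu]_s (kk s * Z (t - s))%:E)%E.
have cv0 t : (0 <= cv t)%E by apply: integral_ge0 => s _; rewrite lee_fin mulr_ge0.
have mcv : measurable_fun [set: R] cv by exact: measurable_convolution.
have Zle : {ae mu, forall t, [set: R] t -> ((Z t)%:E <= M * cv t)%E}.
  apply: lebesgue_aeS wle => t wt _.
  have [tb|tb] := boolP (0 <= t <= b); last first.
    by rewrite /Z (w0 _ tb) expr0n/= mul0r mule_ge0.
  have H : ((w t ^+ 2)%:E <= M * \int[mu]_s ((k s * w (t - s)) ^+ 2)%:E)%E.
    have := integral_cauchy_schwarz (measurable_comp_subl t mm)
      (measurable_funM mk (measurable_comp_subl t mw)).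
    rewrite (ge0_integral_subl (f := fun x => (m x ^+ 2)%:E)); last 2 first.
    - by apply/measurable_EFinP; exact: measurable_funX.
    - by move=> x; rewrite lee_fin sqr_ge0.
    apply: le_trans.
    apply: (@le_trans _ _ ((`|w t|)%:E `^ 2)%E).
      by rewrite poweR_EFin lee_fin powR_mulrn// -normrX ler_norm.
    apply: gt0_ler_poweR => //; rewrite ?in_itv/= ?leey ?andbT ?lee_fin//.
      by apply: integral_ge0.
    exact: wt.
  rewrite /Z EFinM.
  apply: (@le_trans _ _ (M * \int[mu]_s ((k s * w (t - s)) ^+ 2)%:E *
      (expR (- (beta * t)))%:E)%E).
    by rewrite lee_wpmul2r// lee_fin expR_ge0.
  rewrite -muleA lee_wpmul2l// -ge0_integralZr//; last 2 first.
  - apply/measurable_EFinP; apply: measurable_funX.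
    by apply: measurable_funM => //; exact: measurable_comp_subl.
  - by move=> x _; rewrite lee_fin sqr_ge0.
  (* The two sides are equal: the weight splits as [e^(- beta s) e^(- beta (t - s))], and outside
     [[0, b]] either [k s = 0] or [t - s < 0], where [w] vanishes. *)
  rewrite le_eqVlt; apply/orP; left; apply/eqP.
  apply: eq_integral => s _; rewrite -EFinM; congr EFin.
  rewrite /kk patchE mem_setE in_itv/= /Z.
  case: ifPn => [_|].
    rewrite exprMn [RHS]mulrACA -expRD; congr (_ * expR _); ring.
  have [s0|s0 /= sb] := ltP s 0.
    by rewrite k_lt0// !mul0r expr0n mul0r.
  rewrite w0 ?mulr0 ?expr0n ?mul0r//.
  by apply/negP => /andP[st _]; move: tb sb => /andP[_ tb]; lra.
have IZ0 : (0 <= \int[mu]_t (Z t)%:E)%E by apply: integral_ge0 => x _; rewrite lee_fin.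
(* Finiteness is what permits absorbing the right-hand side; it holds because the weight is at most
   1 on [[0, b]]. *)
have IZfin : (\int[mu]_t (Z t)%:E)%E \is a fin_num.
  rewrite ge0_fin_numE//; apply: le_lt_trans w2.
  apply: ge0_le_integral => //.
  - by move=> t _; rewrite lee_fin.
  - exact/measurable_EFinP.
  - by apply/measurable_EFinP; exact: measurable_funX.
  move=> t _; rewrite lee_fin /Z.
  have [/andP[t0 tb]|tb] := boolP (0 <= t <= b); last first.
    by rewrite w0// expr0n mul0r.
  by rewrite ler_piMr ?sqr_ge0// -expR0 ler_expR oppr_le0 mulr_ge0.
have : (\int[mu]_t (Z t)%:E <= M * ((\int[mu]_s (kk s)%:E) * \int[mu]_t (Z t)%:E))%E.
  rewrite -integral_convolution// -ge0_integralZl//; last first.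
    by move=> x _; exact: cv0.
  apply: ae_ge0_le_integral => //.
  - by move=> x _; rewrite lee_fin.
  - exact/measurable_EFinP.
  - by move=> x _; apply: mule_ge0 => //; exact: cv0.
  - exact: measurable_funeM.
have kke : (\int[mu]_s (kk s)%:E = \int[mu]_(s in `[0%R, b]) (k s ^+ 2 * expR (- (beta * s)))%:E)%E.
  rewrite [RHS]integral_mkcond; apply: eq_integral => s _.
  by rewrite /kk !patchE; case: ifP.
have Ik0 : (0 <= \int[mu]_s (kk s)%:E)%E by apply: integral_ge0 => x _; rewrite lee_fin.
move: kap; rewrite -kke gee0_abs// => kap.
have Ikfin : (\int[mu]_s (kk s)%:E)%E \is a fin_num by rewrite ge0_fin_numE// (lt_trans kap) ?ltry.
move=> zle0; have : fine (\int[mu]_t (Z t)%:E)%E <=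
    fine M * (fine (\int[mu]_s (kk s)%:E)%E * fine (\int[mu]_t (Z t)%:E)%E).
  by rewrite -lee_fin !EFinM !fineK.
have {kap} : fine (\int[mu]_s (kk s)%:E)%E < (2 * (fine M + 1))^-1.
  by rewrite -lte_fin fineK.
have f1 : 0 < 2 * (fine M + 1) by rewrite mulr_gt0// ltr_wpDl// fine_ge0.
rewrite -div1r ltr_pdivlMr// => qlt zle.
have z_eq0 : fine (\int[mu]_t (Z t)%:E)%E = 0.
  exact: (contraction_eq0 (fine_ge0 M0) (fine_ge0 Ik0) (fine_ge0 IZ0) qlt zle).
(* A nonnegative function of zero integral vanishes almost everywhere, and the exponential factor of
   [Z] is positive. *)
have : (\int[mu]_t `|(Z t)%:E|)%E = 0%E.
  under eq_integral do rewrite gee0_abs ?lee_fin//.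
  by rewrite -(fineK IZfin) z_eq0.
move=> /(ae_eq_integral_abs mu measurableT).
have mZE : measurable_fun [set: R] (EFin \o Z) by exact/measurable_EFinP.
move=> /(_ mZE); apply: lebesgue_aeS => t /(_ I) [] /eqP.
by rewrite /Z mulf_eq0 [expR _ == 0]gt_eqF ?expR_gt0// orbF expf_eq0/= => /eqP.
Qed.

End uniqueness.

(** The identity [Q u - Q psi = (a (u + psi) + lam) (u - psi)] makes the equation for the difference
    linear, with a coefficient [m] in L^2 because [u] is in L^2 and [psi] is bounded. *)
Lemma quadratic_volterra_unique (R : realType) (k : R -> R) (a lam c xs b : R)
    (psi u : R -> R) :
  let Q x := a * x ^+ 2 + lam * x + c in
  measurable_fun [set: R] k ->
  (forall x, x < 0 -> k x = 0) ->
  (@lebesgue_measure R).-integrable `[0, b] (EFin \o (fun s => k s ^+ 2)) ->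
  measurable_fun [set: R] psi -> (forall t, 0 <= psi t <= xs) ->
  measurable_fun `[0, b] u ->
  (\int[@lebesgue_measure R]_(x in `[0%R, b]) ((u x) ^+ 2)%:E < +oo)%E ->
  (forall t, 0 <= t ->
    (@lebesgue_measure R).-integrable `[0, t] (EFin \o (fun s => k s * Q (psi (t - s)))) /\
    psi t = \int[@lebesgue_measure R]_(s in `[0, t]) (k s * Q (psi (t - s)))) ->
  {ae @lebesgue_measure R, forall t, 0 <= t <= b ->
    (@lebesgue_measure R).-integrable `[0, t] (EFin \o (fun s => k s * Q (u (t - s)))) /\
    u t = \int[@lebesgue_measure R]_(s in `[0, t]) (k s * Q (u (t - s)))} ->
  {ae @lebesgue_measure R, forall t, 0 <= t <= b -> u t = psi t}.
Proof.
move=> Q mk klt0 ik2 mpsi psib meas_u u2 psiE uE; set mu := @lebesgue_measure R.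
(* The factor 1 and the sum give the form [A * u + h] of [integral_affine_sqr_lty]. *)
pose w := (fun t => 1 * u t + - psi t) \_ `[0, b].
pose m := (fun t => a * u t + (a * psi t + lam)) \_ `[0, b].
have mpsi1 : measurable_fun [set: R] (fun t => - psi t) by exact: measurable_funN.
have mpsi2 : measurable_fun [set: R] (fun t => a * psi t + lam).
  by apply: measurable_funD => //; exact: measurable_funM.
have mw : measurable_fun [set: R] w.
  apply/(measurable_restrictT _ _).1 => //; apply: measurable_funD.
    exact: measurable_funM.
  exact: measurable_funTS.
have mm : measurable_fun [set: R] m.
  apply/(measurable_restrictT _ _).1 => //; apply: measurable_funD.
    exact: measurable_funM.
  exact: measurable_funTS.
have restr2 (f : R -> R) :
    (\int[mu]_x (((f \_ `[0, b]) x) ^+ 2)%:E = \int[mu]_(x in `[0%R, b]) (f x ^+ 2)%:E)%E.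
  rewrite [RHS]integral_mkcond; apply: eq_integral => x _.
  by rewrite !patchE; case: ifP => // _; rewrite expr0n.
have w2 : (\int[mu]_t ((w t) ^+ 2)%:E < +oo)%E.
  rewrite restr2; apply: (@integral_affine_sqr_lty _ _ (fun t => - psi t) _ _ xs) => //.
  by move=> x; have /andP[p0 pxs] := psib x; rewrite normrN ger0_norm.
have m2 : (\int[mu]_t ((m t) ^+ 2)%:E < +oo)%E.
  rewrite restr2.
  apply: (@integral_affine_sqr_lty _ _ (fun t => a * psi t + lam) _ _ (`|a| * xs + `|lam|)) => //.
  move=> x; have /andP[p0 pxs] := psib x.
  rewrite (le_trans (ler_normD _ _))// lerD2r normrM ler_wpM2l//.
  by rewrite ger0_norm.
have w0 t : ~~ (0 <= t <= b) -> w t = 0.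
  by move=> tb; rewrite /w patchE mem_setE in_itv/= (negbTE tb).
suff : {ae mu, forall t, w t = 0}.
  apply: lebesgue_aeS => t + tb; rewrite /w patchE mem_setE in_itv/= tb mul1r.
  by move/eqP; rewrite subr_eq0 => /eqP.
apply: (convolution_ineq_eq0 mk klt0 ik2 mm mw w0 m2 w2).
apply: lebesgue_aeS uE => t /[swap] /andP[t0 tb]; rewrite t0 tb => /(_ isT) [iu ut].
have [ip pt] := psiE _ t0.
have wt : w t = \int[mu]_(s in `[0, t]) (m (t - s) * (k s * w (t - s))).
  rewrite {1}/w patchE mem_setE in_itv/= t0 tb mul1r ut pt -RintegralB//.
  apply: eq_Rintegral => s; rewrite inE/= in_itv/= => /andP[s0 st].
  have tsb : 0 <= t - s <= b by rewrite subr_ge0 st lerBlDr (le_trans tb)// lerDl.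
  by rewrite /m /w !patchE !mem_setE !in_itv/= tsb /Q; ring.
have mmw : measurable_fun [set: R] (fun s => m (t - s) * (k s * w (t - s))).
  by apply: measurable_funM; [exact: measurable_comp_subl|
    apply: measurable_funM => //; exact: measurable_comp_subl].
rewrite wt.
apply: (@le_trans _ _ (\int[mu]_(s in `[0%R, t]) (`|m (t - s) * (k s * w (t - s))|)%:E)%E).
  have mmw' : measurable_fun `[0, t] (EFin \o (fun s => m (t - s) * (k s * w (t - s)))).
    by apply/measurable_EFinP; exact: measurable_funTS.
  apply: (le_trans _ (le_abse_integral mu (measurable_itv _) mmw')).
  (* For an infinite integral [fine] returns 0 and the bound is trivial. *)
  by rewrite /Rintegral; case: (integral _ _ _) => [r||] //=; rewrite normr0 leey.
apply: ge0_subset_integral => //.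
by apply/measurable_EFinP; exact: measurableT_comp.
Qed.

(** * The vector equation *)

(* Complete monotonicity says nothing about [K 0], hence the restriction. *)
Lemma kernel_assumption_pos (R : realType) (T : R) (K : R -> R)
    (k := K \_ `]0, +oo[) : kernel_assumption T K ->
  [/\ measurable_fun [set: R] k, forall x, 0 <= k x,
      forall s s', 0 < s -> s <= s' -> k s' <= k s,
      forall b, (@lebesgue_measure R).-integrable `[0, b] (EFin \o k)
    & forall b, (@lebesgue_measure R).-integrable `[0, b] (EFin \o (fun s => k s ^+ 2))].
Proof.
move=> [[mK K2] cmK _]; set mu := @lebesgue_measure R.
have kE s : 0 < s -> k s = K s by move=> s0; rewrite /k patchE mem_setE in_itv/= s0.
have mk : measurable_fun [set: R] k.
  apply/(measurable_restrictT _ _).1 => //; apply: measurable_funS mK => //.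
  by apply: subset_itvr; rewrite bnd_simp.
have k0 x : 0 <= k x.
  rewrite /k patchE mem_setE in_itv/= andbT; case: ifPn => // x0.
  by have [_] := cmK 0%N _ x0; rewrite expr0 mul1r.
have mk2 (b : R) : measurable_fun `[0, b] (EFin \o (fun s => k s ^+ 2)).
  by apply/measurable_EFinP; apply: measurable_funTS; exact: measurable_funX.
have ik2 b : 0 < b -> mu.-integrable `[0, b] (EFin \o (fun s => k s ^+ 2)).
  move=> b0; apply/integrableP; split; first exact: mk2.
  move: (K2 _ b0) => /Lnorm2_restrict_lty; apply: le_lt_trans.
  apply: ge0_le_integral => //.
  - exact: (measurableT_comp _ (mk2 b)).
  - apply/measurable_EFinP; apply: measurable_funX; apply: measurable_funS mK => //.
    by apply: subset_itvl; rewrite bnd_simp.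
  move=> x _; rewrite /= lee_fin ger0_norm ?sqr_ge0//.
  rewrite /k patchE mem_setE in_itv/= andbT; case: ifPn => // _.
  by rewrite expr0n/= sqr_ge0.
have {}ik2 b : mu.-integrable `[0, b] (EFin \o (fun s => k s ^+ 2)).
  (* [L2_loc] speaks of positive [b] only; other intervals are contained in one of these. *)
  have b1 : 0 < Num.max b 1 by rewrite lt_max ltr01 orbT.
  apply: integrableS (ik2 _ b1) => //.
  by apply: subset_itvl; rewrite bnd_simp le_max lexx.
split=> //.
- move=> s s' s0 ss'; rewrite !kE ?(lt_le_trans s0)//.
  have dK x : 0 < x -> derivable K x 1.
    by move=> x0; have [] := cmK 0%N _ x0.
  apply: (@ler0_derive1_nincry _ K s) => //.
  - by move=> x; rewrite in_itv/= andbT => sx; apply: dK; exact: lt_trans sx.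
  - move=> x; rewrite in_itv/= andbT => sx; have [_] := cmK 1%N _ (lt_trans s0 sx).
    by rewrite expr1 mulN1r oppr_ge0.
  - apply: derivable_within_continuous => x; rewrite in_itv/= andbT => sx.
    exact: dK (lt_le_trans s0 sx).
(* On a bounded interval L^2 gives L^1 through [k <= 1 + k^2]. *)
- move=> b; apply: (@le_integrable _ _ _ mu _ _ _ (fun s => (1 + k s ^+ 2)%:E)) => //.
  + by apply/measurable_EFinP; exact: measurable_funTS.
  + move=> s _; rewrite lee_fin !ger0_norm ?addr_ge0 ?sqr_ge0//.
    by have := sqr_ge0 (k s - 1); have := k0 s; nra.
  + have i1 : mu.-integrable `[0, b] (EFin \o cst 1).
      apply: measurable_bounded_integrable => //.
        by rewrite /= lebesgue_measure_itv/=; case: ifP => _; rewrite ?ltry.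
      exact: bounded_cst.
    exact: (@integrableD _ _ _ mu _ (measurable_itv _) _ _ i1 (ik2 b)).
Qed.

(** Products with diagonal matrices act entrywise, so the coordinates decouple. *)
Lemma F2E (R : realType) (d : nat) (gamma : R) (theta nu rho delta x : 'rV[R]_d) (j : 'I_d) :
  F2 gamma theta nu rho delta x 0 j =
  (2^-1 * (nu 0 j ^+ 2 + gamma / (1 - gamma) * (nu 0 j ^+ 2 * rho 0 j ^+ 2))) * x 0 j ^+ 2
  + (delta 0 j + gamma / (1 - gamma) * nu 0 j * rho 0 j * theta 0 j) * x 0 j
  + gamma / (2 * (1 - gamma)) * theta 0 j ^+ 2.
Proof.
rewrite /F2 /Lambda_mx.
have sqrE (v : 'rV[R]_d) : diag_mx v ^+ 2 = diag_mx (\row_i (v 0 i * v 0 i)).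
  by rewrite expr2 -mulmx_diag.
rewrite !sqrE !mulmx_diag mulmxDr -scalemxAr !mul_mx_diag !mxE; ring.
Qed.

Lemma kernel_mxE (R : realType) (d : nat) (F : 'rV[R]_d -> 'rV[R]_d)
    (K : 'I_d -> R -> R) (psi : R -> 'rV[R]_d) (t s : R) (j : 'I_d) :
  volterra_integrand F (kernel_mx K) psi t s 0 j = F (psi (t - s)) 0 j * K j s.
Proof. by rewrite /volterra_integrand /kernel_mx mul_mx_diag !mxE. Qed.

Lemma L2norm_lty (R : realType) (d : nat) (b : R) (psi : R -> 'rV[R]_d) :
  (L2norm b psi < +oo)%E <->
  (\int[@lebesgue_measure R]_(t in `[0%R, b]) (\sum_(i < d) psi t 0 i ^+ 2)%:E < +oo)%E.
Proof.
rewrite (_ : (\int[_]_(t in _) _)%E = (\int[@lebesgue_measure R]_(t in `[0%R, b])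
    ((euclidean_norm (psi t)) ^+ 2)%:E)%E); first exact: Lnorm2_restrict_lty.
apply: eq_integral => t _; congr EFin; rewrite sqr_sqrtr// sumr_ge0// => i _.
exact: sqr_ge0.
Qed.

Lemma integral_coord_sqr_lty (R : realType) (d : nat) (b : R) (psi : R -> 'rV[R]_d) (i : 'I_d) :
  in_L2 b psi ->
  (\int[@lebesgue_measure R]_(t in `[0%R, b]) (psi t 0 i ^+ 2)%:E < +oo)%E.
Proof.
move=> [mpsi /L2norm_lty]; apply: le_lt_trans; apply: ge0_le_integral => //.
- by move=> t _; rewrite lee_fin sqr_ge0.
- apply/measurable_EFinP.
  exact: (@measurable_funX _ _ _ _ (fun t => psi t 0 i)).
- apply/measurable_EFinP; apply: measurable_sum => j.
  exact: (@measurable_funX _ _ _ _ (fun t => psi t 0 j)).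
- move=> t _; rewrite lee_fin (bigD1 i)//= lerDl sumr_ge0// => j _.
  exact: sqr_ge0.
Qed.

Lemma bounded_in_L2 (R : realType) (d : nat) (b B : R) (psi : R -> 'rV[R]_d) :
  (forall i, measurable_fun [set: R] (fun t => psi t 0 i)) ->
  (forall i t, `|psi t 0 i| <= B) -> in_L2 b psi.
Proof.
move=> mpsi psiB; split; first by move=> i; exact: measurable_funTS.
apply/L2norm_lty; set mu := @lebesgue_measure R.
apply: (@le_lt_trans _ _ (\int[mu]_(t in `[0%R, b]) (cst (\sum_(i < d) B ^+ 2)%:E t))%E).
  apply: ge0_le_integral => //.
  - by move=> t _; rewrite lee_fin sumr_ge0// => i _; exact: sqr_ge0.
  - apply/measurable_EFinP; apply: measurable_sum => j.
    apply: (@measurable_funX _ _ _ _ (fun t => psi t 0 j)).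
    exact: measurable_funTS.
  - move=> t _; rewrite lee_fin; apply: ler_sum => i _.
    by rewrite -real_normK ?num_real// ler_sqr ?nnegrE// (le_trans _ (psiB i t)).
rewrite integral_cst//= lebesgue_measure_itv/=.
by case: ifP => _; rewrite -?EFinB -?EFinM ?mule0 ltry.
Qed.

Theorem theorem6p3 (R : realType) (d : nat) (hd : (1 <= d)%N)
  (T : R) (hT : 0 < T)
  (K : 'I_d -> R -> R) (hK : forall i : 'I_d, kernel_assumption T (K i))
  (gamma : R) (hgamma0 : 0 < gamma) (hgamma1 : gamma < 1)
  (theta nu rho delta : 'rV[R]_d)
  (htheta : forall i : 'I_d, 0 <= theta 0 i)
  (hrho : forall i : 'I_d, -1 <= rho 0 i <= 1)
  (hneg : forall i : 'I_d,
     delta 0 i + gamma / (1 - gamma) * nu 0 i * rho 0 i * theta 0 i < 0)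
  (hdisc : forall i : 'I_d,
     (delta 0 i + gamma / (1 - gamma) * nu 0 i * rho 0 i * theta 0 i) ^+ 2
     - gamma / (1 - gamma)
       * ((1 - gamma + gamma * rho 0 i ^+ 2) / (1 - gamma))
       * nu 0 i ^+ 2 * theta 0 i ^+ 2 > 0) :
  has_unique_global_solution (F2 gamma theta nu rho delta) (kernel_mx K).
Proof.
set mu := @lebesgue_measure R.
pose a i := 2^-1 * (nu 0 i ^+ 2 + gamma / (1 - gamma) * (nu 0 i ^+ 2 * rho 0 i ^+ 2)).
pose lam i := delta 0 i + gamma / (1 - gamma) * nu 0 i * rho 0 i * theta 0 i.
pose c i := gamma / (2 * (1 - gamma)) * theta 0 i ^+ 2.
pose Q i x := a i * x ^+ 2 + lam i * x + c i.
pose k i := K i \_ `]0, +oo[.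
have g1 : 0 < 1 - gamma by rewrite subr_gt0.
have g0 : 0 < gamma / (1 - gamma) by rewrite divr_gt0.
have sol i : exists p : (R -> R) * R, [/\ measurable_fun [set: R] p.1,
    forall t, 0 <= p.1 t <= p.2 &
    forall t, mu.-integrable `[0, t] (EFin \o (fun s => k i s * Q i (p.1 (t - s)))) /\
      p.1 t = \int[mu]_(s in `[0, t]) (k i s * Q i (p.1 (t - s)))].
  have [mk k0 kn ik _] := kernel_assumption_pos (hK i).
  have a0 : 0 <= a i.
    apply: mulr_ge0 => //; apply: addr_ge0; first exact: sqr_ge0.
    by apply: mulr_ge0; [exact: ltW|apply: mulr_ge0; exact: sqr_ge0].
  have c0 : 0 <= c i.
    by apply: mulr_ge0; [rewrite divr_ge0 ?mulr_ge0// ltW|exact: sqr_ge0].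
  (* The product subtracted in [hdisc] is exactly [4 * a i * c i], so the assumption is positivity
     of the discriminant. *)
  have D0 : 0 < lam i ^+ 2 - 4 * a i * c i.
    have := hdisc i; rewrite -/(lam i); congr (0 < _); congr (_ - _).
    rewrite /a /c; field; exact: lt0r_neq0.
  have [psi [xs psiP]] := quadratic_volterra_solution mk k0 kn ik a0 (hneg i) c0 D0.
  by exists (psi, xs).
have [p pP] := choice sol.
pose psi t : 'rV[R]_d := \row_i (p i).1 t.
have kK i (h : R -> R) s t : 0 < s <= t -> k i s * h s = h s * K i s.
  by move=> /andP[s0 _]; rewrite /k patchE mem_setE in_itv/= s0 mulrC.
have F2Q x i : F2 gamma theta nu rho delta x 0 i = Q i (x 0 i) by exact: F2E.
have intE (u : R -> 'rV[R]_d) t j :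
    (fun s => volterra_integrand (F2 gamma theta nu rho delta) (kernel_mx K) u t s 0 j) =
    (fun s => Q j (u (t - s) 0 j) * K j s).
  by apply/funext => s; rewrite kernel_mxE F2Q.
have psi_in b : in_L2 b psi.
  (* The scalar bounds are nonnegative, so their sum bounds every coordinate. *)
  apply: (@bounded_in_L2 _ _ _ (\sum_i (p i).2)).
    move=> i; have [mp _ _] := pP i.
    by rewrite (_ : (fun t => _) = (p i).1)//; apply/funext => t; rewrite mxE.
  move=> i t; rewrite mxE; have [_ pb _] := pP i.
  have /andP[p0 pxs] := pb t; rewrite ger0_norm// (le_trans pxs)//.
  rewrite (bigD1 i)//= lerDl sumr_ge0// => j _; have [_ pbj _] := pP j.
  by have /andP[] := pbj 0; exact: le_trans.
have psi_sol t : solves_at (F2 gamma theta nu rho delta) (kernel_mx K) psi t.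
  have H j := @eq_oc_integral R _ _ t (kK j (fun s => Q j (psi (t - s) 0 j)) ^~ t).
  have E j : (fun s => k j s * Q j (psi (t - s) 0 j)) = (fun s => k j s * Q j ((p j).1 (t - s))).
    by apply/funext => s; rewrite mxE.
  split=> [j|].
    have [_ _ /(_ t)[ip _]] := pP j.
    rewrite -E in ip; have [ip' _] := H j ip.
    move: ip'; congr (is_true (integrable _ _ _)).
    by apply/funext => s; rewrite /= kernel_mxE F2Q.
  apply/rowP => j; rewrite !mxE intE.
  have [_ _ /(_ t)[ip pt]] := pP j.
  rewrite -E in ip; have [_ <-] := H j ip.
  by rewrite pt E.
(* With infinite lifetime the blow-up clause is vacuous. *)
exists psi, +oo%E; split=> //.
move=> b u b0 uL2 usol; split; first exact: ltry.
have {}usol j : {ae mu, forall t, 0 <= t <= b -> u t 0 j = (p j).1 t}.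
  have [mk k0 kn ik ik2] := kernel_assumption_pos (hK j).
  have [mp pb psol] := pP j.
  apply: (quadratic_volterra_unique (k := k j) (a := a j) (lam := lam j) (c := c j) (xs := (p j).2)) => //.
  - move=> x x0; rewrite /k patchE mem_setE in_itv/= andbT ltNge ltW//.
  - by have [meas_u _] := uL2; exact: meas_u.
  - exact: integral_coord_sqr_lty.
  apply: lebesgue_aeS usol => t + tb => /(_ tb)[iu ut].
  have [||ik' <-] := @eq_oc_integral R (fun s => Q j (u (t - s) 0 j) * K j s)
    (fun s => k j s * Q j (u (t - s) 0 j)) t.
  - by move=> s st; rewrite (kK j (fun s => Q j (u (t - s) 0 j)) _ _ st).
  - by have := iu j; rewrite -intE.
  - by split=> //; rewrite ut mxE intE.
(* The exceptional null sets of the finitely many coordinates are united. *)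
have := lebesgue_ae_forall usol; apply: lebesgue_aeS => t H tb.
by apply/rowP => j; rewrite H// mxE.
Qed.
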